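(* Let $n\in\mathbb{N}$, let $\pi\in S_n$ be a fixed permutation, and let $1\leq \ell<d<n$ be integers. Then $$c_d(\pi)\leq \left(c_\ell(\pi)\binom{d}{\ell}\right)^{d/\ell}.$$
   Context: $S_m$ denotes the set of permutations of $[m]=\{1,\dots,m\}$, viewed as sequences $\pi=\pi_1\cdots\pi_m$. A pattern of length $k$ is a permutation $v\in S_k$. A sequence of $k$ distinct numbers is order-isomorphic to $v\in S_k$ (equivalently, reduces to $v$) if its entries are in the same relative order as $v_1,\dots,v_k$. For $\pi\in S_n$ and $k\leq n$, an occurrence of $v\in S_k$ in $\pi$ is a set of indices $j_1<\dots<j_k$ such that $\pi_{j_1}\cdots\pi_{j_k}$ is order-isomorphic to $v$; $\pi$ contains $v$ if there is at least one occurrence. $C_k(\pi)$ is the set of all patterns $v\in S_k$ that occur in $\pi$, and $c_k(\pi)=\#C_k(\pi)$. *)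

(* Defs.v *)
From HB Require Import structures.
From mathcomp Require Import all_boot all_order all_algebra all_fingroup.
From mathcomp Require Import reals exp.

Set Implicit Arguments.
Unset Strict Implicit.
Unset Printing Implicit Defensive.

(* Permutations of [m] are elements of 'S_m = {perm 'I_m}: positions and values
   are numbered from 0, so the entry pi_(i+1) is (pi i).+1. *)

Definition order_isomorphic (k : nat) (s : 'I_k -> nat) (v : 'S_k) : bool :=
  [forall a, forall b, (s a < s b) == (v a < v b)].

(* The index set j_1 < ... < j_k is given by its increasing enumeration j. *)
Definition occurrence (k n : nat) (v : 'S_k) (pi : 'S_n)
    (j : {ffun 'I_k -> 'I_n}) : bool :=
  [forall a : 'I_k, forall b : 'I_k, (a < b) ==> (j a < j b)]
  && order_isomorphic (fun a => pi (j a)) v.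

Definition contains (k n : nat) (pi : 'S_n) (v : 'S_k) : bool :=
  [exists j : {ffun 'I_k -> 'I_n}, occurrence v pi j].

Definition patterns (k n : nat) (pi : 'S_n) : {set 'S_k} :=
  [set v | contains pi v].

Definition num_patterns (k n : nat) (pi : 'S_n) : nat := #|patterns k pi|.

(* Main.v *)
(* View the patterns of length d as functions from positions to values, i.e.
   as a family F of points with d coordinates.  The restriction of a member of
   F to an l-set of positions is determined by its pattern, which occurs in pi,
   and by its set of values, so every projection of F to l coordinates has at
   most K = c_l(pi) * 'C(d, l) elements.  Shearer's inequality for the d cyclic
   intervals of l coordinates then gives #|F|^l <= K^d. *)

Require Import Defs.
From HB Require Import structures.
From mathcomp Require Import all_boot all_order all_algebra all_fingroup all_field.
From mathcomp Require Import reals exp.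

Set Implicit Arguments.
Unset Strict Implicit.
Unset Printing Implicit Defensive.

Import Order.TTheory GRing.Theory Num.Theory.
Local Open Scope ring_scope.

(* Hoelder's inequality for #|P| families with all exponents 1/#|P|, with the
   roots cleared; c absorbs factors that do not depend on a. *)
Lemma holder_expr (C : numClosedFieldType) (A J : finType) (P : {pred J})
    (c : C) (u : A -> C) (x : J -> A -> C) :
    (0 < #|P|)%N -> 0 <= c -> (forall a, 0 <= u a) ->
    (forall j a, 0 <= x j a) ->
    (forall a, u a ^+ #|P| <= c * \prod_(j in P) x j a) ->
  (\sum_a u a) ^+ #|P| <= c * \prod_(j in P) \sum_a x j a.
Proof.
move=> k_gt0 c0 u0 x0 hu; set S := fun j => \sum_a x j a.
have S0 j : 0 <= S j by apply: sumr_ge0.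
have P0 : 0 <= c * \prod_(j in P) S j by rewrite mulr_ge0 // prodr_ge0.
(* A vanishing sum cannot be normalised; it makes every [x j a] zero for that [j], and then every
   [u a] is zero too. *)
have [/existsP [j /andP [jP /eqP Sj]]|] := boolP [exists j in P, S j == 0].
  rewrite big1 ?expr0n ?gtn_eqF // => a _; apply/eqP.
  have xja : x j a = 0.
    move/eqP: Sj; rewrite psumr_eq0 // => /allP/(_ a (mem_index_enum _)).
    by move/eqP.
  have := hu a; rewrite (bigD1 j) //= xja mul0r mulr0 => hua.
  have: u a ^+ #|P| == 0 by rewrite eq_le hua exprn_ge0.
  by rewrite expf_eq0 => /andP[].
rewrite negb_exists => /forallP Sn0.
have {}Sn0 j : j \in P -> S j != 0 by move=> jP; have := Sn0 j; rewrite jP.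
set G := #|P|.-root (c * \prod_(j in P) S j).
have G0 : 0 <= G by rewrite rootC_ge0.
have GE : G ^+ #|P| = c * \prod_(j in P) S j by rewrite rootCK.
(* [mu a] averages the normalised weights. AM-GM gives [u a <= G * mu a], and the [mu a] sum to
   1. *)
pose mu a := (\sum_(j in P) x j a / S j) / #|P|%:R.
have mu0 a : 0 <= mu a.
  by rewrite divr_ge0 ?ler0n // sumr_ge0 // => j _; rewrite divr_ge0.
have hum a : u a <= G * mu a.
  rewrite -(ler_pXn2r k_gt0) ?nnegrE ?(mulr_ge0 G0) //; apply: le_trans (hu a) _.
  rewrite exprMn GE -mulrA ler_wpM2l //.
  have -> : \prod_(j in P) x j a = \prod_(j in P) S j * \prod_(j in P) (x j a / S j).
    rewrite -big_split /=; apply: eq_bigr => j jP.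
    by rewrite mulrCA mulfV ?mulr1 // Sn0.
  rewrite ler_wpM2l ?prodr_ge0 //.
  by apply: (leif_AGM (E := fun j => x j a / S j)) => j _; rewrite divr_ge0.
rewrite -GE (ler_pXn2r k_gt0) ?nnegrE ?sumr_ge0 //.
apply: le_trans (ler_sum _ (fun a _ => hum a)) _.
rewrite -mulr_sumr -mulr_suml exchange_big /=.
rewrite (eq_bigr (fun=> 1)) => [|j jP].
  by rewrite sumr_const divff ?mulr1 // pnatr_eq0 -lt0n.
by rewrite -mulr_suml divff // Sn0.
Qed.

Lemma holder_expn (A J : finType) (P : {pred J}) (c : nat) (u : A -> nat)
    (x : J -> A -> nat) :
    (0 < #|P|)%N ->
    (forall a, u a ^ #|P| <= c * \prod_(j in P) x j a)%N ->
  ((\sum_a u a) ^ #|P| <= c * \prod_(j in P) \sum_a x j a)%N.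
Proof.
move=> k_gt0 hu; rewrite -(ler_nat algC) natrX natr_sum natrM natr_prod.
under [X in _ <= _ * X]eq_bigr do rewrite natr_sum.
by apply: holder_expr => // a; rewrite -natr_prod -natrX -natrM ler_nat.
Qed.

Local Open Scope nat_scope.

(** On [F], [f] factors through [g]. The induced map takes option values because [T1] may be
    empty. *)
Lemma card_imset_le_factor (X T1 T2 : finType) (F : {set X})
    (f : X -> T1) (g : X -> T2) :
    {in F &, forall x y, g x = g y -> f x = f y} ->
  #|f @: F| <= #|g @: F|.
Proof.
move=> fg.
pose h t := if [pick x in F | g x == t] is Some x then Some (f x) else None.
have hE : {in F, forall x, h (g x) = Some (f x)}.
  move=> x xF; rewrite /h; case: pickP => [y /andP[yF /eqP e]|/(_ x)].
    by rewrite (fg _ _ yF xF e).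
  by rewrite xF eqxx.
rewrite -(card_imset (mem (f @: F)) (@Some_inj _)).
apply: leq_trans (leq_imset_card h (g @: F)); apply/subset_leq_card/subsetP => t.
case/imsetP => ? /imsetP[x xF ->] ->.
by apply/imsetP; exists (g x); rewrite ?hE ?imset_f.
Qed.

(** * Shearer's inequality for projections of a finite family *)

Section Shearer.

Variables (X I V : finType) (coord : X -> I -> V).

(** Marking the forgotten coordinates by [None] keeps the projections to all sets [S] in one finite
    type. *)
Definition restriction (S : {set I}) (x : X) : {ffun I -> option V} :=
  [ffun i => if i \in S then Some (coord x i) else None].

Definition trace (F : {set X}) (S : {set I}) := restriction S @: F.

Definition fiber (F : {set X}) (i : I) (a : V) := [set x in F | coord x i == a].

Lemma eq_restriction (S : {set I}) x y :
  restriction S x = restriction S y <-> {in S, coord x =1 coord y}.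
Proof.
split=> [e i iS|e]; last by apply/ffunP=> i; rewrite !ffunE; case: ifP => // /e ->.
by move/ffunP/(_ i): e; rewrite !ffunE iS => -[].
Qed.

(** The value at [i] splits the trace into disjoint classes, one per fiber; inside a fiber
    coordinate [i] is constant, so forgetting it merges nothing. *)
Lemma card_trace_fiber (F : {set X}) (S : {set I}) i :
  i \in S -> #|trace F S| = \sum_a #|trace (fiber F i a) (S :\ i)|.
Proof.
move=> iS; rewrite -sum1_card.
have ptP t : t \in trace F S -> exists a, t i = Some a.
  by case/imsetP => x xF ->; exists (coord x i); rewrite ffunE iS.
under [RHS]eq_bigr => a _.
  have -> : #|trace (fiber F i a) (S :\ i)| = #|trace (fiber F i a) S|.
    apply/eqP; rewrite eqn_leq !card_imset_le_factor // => x y.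
      rewrite !inE => /andP[_ /eqP xa] /andP[_ /eqP ya] /eq_restriction e.
      apply/eq_restriction => j jS; have [->|ji] := eqVneq j i.
        by rewrite xa ya.
      by apply: e; rewrite !inE ji.
    move=> _ _ /eq_restriction e; apply/eq_restriction => j /setD1P[_]; exact: e.
  have -> : #|trace (fiber F i a) S| = \sum_(t in trace F S | t i == Some a) 1.
    rewrite sum1dep_card; apply: eq_card => t; rewrite !inE.
    apply/imsetP/andP => [[x]|[/imsetP[x xF ->]]].
      rewrite inE => /andP[xF /eqP xa] ->; split; first exact: imset_f.
      by rewrite ffunE iS xa.
    by rewrite ffunE iS => /eqP[xa]; exists x; rewrite // inE xF xa eqxx.
  over.
rewrite (exchange_big_dep (mem (trace F S))) /=; last by move=> a t _ /andP[].
apply: eq_bigr => t tF; have [a ta] := ptP t tF.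
rewrite (eq_bigl (pred1 a)) ?big_pred1_eq // => b.
by rewrite tF ta /= eq_sym; apply/eqP/eqP => [[]|->].
Qed.

Lemma trace_sub (F G : {set X}) S : F \subset G -> trace F S \subset trace G S.
Proof. exact: imsetS. Qed.

(* Induction on S: slice F along a coordinate of S and recombine the slices
   with Hoelder's inequality over the members of the cover that contain it. *)
Lemma shearer (J : finType) (k : nat) (T : J -> {set I}) (S : {set I})
    (F : {set X}) :
    0 < k -> {in S, forall i, #|[pred j | i \in T j]| = k} ->
  #|trace F S| ^ k <= \prod_j #|trace F (T j :&: S)|.
Proof.
move=> k0; move: {2}#|S| (leqnn #|S|) F => m.
elim: m S => [|m IH] S hS F cov.
  have -> : S = set0 by apply/eqP; rewrite -cards_eq0 -leqn0.
  have [->|[x xF]] := set_0Vmem F.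
    by rewrite /trace imset0 cards0 exp0n.
  have F1 : #|trace F set0| <= 1.
    apply: leq_trans (card_imset_le_factor (g := fun=> tt) _) _.
      by move=> y z _ _ _; apply/eq_restriction => j; rewrite inE.
    by apply: leq_trans (max_card _) _; rewrite card_unit.
  apply: (@leq_trans 1); first by rewrite -(exp1n k) leq_exp2r.
  rewrite prodn_gt0 // => j; apply/card_gt0P.
  by exists (restriction (T j :&: set0) x); apply: imset_f.
have [S0|[i iS]] := set_0Vmem S.
  by apply: IH => //; rewrite S0 cards0.
have ck := cov i iS.
(* The factors with [i] outside [T j] form the constant of Hoelder's inequality; the other [k]
   factors become sums over the fibers. *)
rewrite (card_trace_fiber F iS) (bigID [pred j | i \in T j]) /= mulnC.
under [X in _ * X]eq_bigr => j ij.
  rewrite (@card_trace_fiber F _ i) ?inE ?ij //; over.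
rewrite -[in X in X <= _]ck.
apply: (@holder_expn _ _ [pred j | i \in T j]); first by rewrite ck.
move=> a; rewrite ck; apply: leq_trans (IH (S :\ i) _ (fiber F i a) _) _.
- by move: hS; rewrite (cardsD1 i) iS.
- by move=> j /setD1P[_]; exact: cov.
(* If [i] is outside [T j], removing it from [S] changes nothing and slicing only shrinks the
   trace. *)
rewrite (bigID [pred j | i \in T j]) /= mulnC leq_mul //.
  apply: leq_prod => j ij; apply: subset_leq_card.
  have -> : T j :&: (S :\ i) = T j :&: S.
    by apply/setP => h; rewrite !inE; case: eqVneq => // ->; rewrite (negPf ij).
  by apply: trace_sub; apply/subsetP => x; rewrite inE => /andP[].
by apply: eq_leq; apply: eq_bigr => j ij; rewrite setIDA.
Qed.

End Shearer.

(** * Ranks in subsets of ['I_d] *)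

Section Rank.

Variable d : nat.
Implicit Types (A T : {set 'I_d}) (p q : 'I_d).

Definition rank A p := #|[set q in A | q < p]|.

Lemma ltn_rank A p q : p \in A -> (rank A p < rank A q) = (p < q).
Proof.
move=> pA; case: (ltnP p q) => pq.
  apply: proper_card; apply/properP; split.
    by apply/subsetP => y; rewrite !inE => /andP[-> /= /ltn_trans->].
  by exists p; rewrite !inE pA ?ltnn.
apply/negbTE; rewrite -leqNgt; apply/subset_leq_card/subsetP => y.
by rewrite !inE => /andP[-> /= /leq_trans->].
Qed.

Lemma rank_inj A : {in A &, injective (rank A)}.
Proof.
move=> p q pA qA e; apply/val_inj/eqP; rewrite eqn_leq leqNgt (leqNgt q).
by rewrite -(@ltn_rank A q p) // -(@ltn_rank A p q) // e ltnn.
Qed.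

Lemma rank_lt_card A p : p \in A -> rank A p < #|A|.
Proof.
move=> pA; apply: proper_card; apply/properP; split.
  by apply/subsetP => y; rewrite !inE => /andP[].
by exists p; rewrite // !inE ltnn andbF.
Qed.

Lemma rank_onto A a : a < #|A| -> exists2 p, p \in A & rank A p = a.
Proof.
move=> aA; pose f p := insubd (Ordinal aA) (rank A p).
have fE p : p \in A -> f p = rank A p :> nat.
  by move=> pA; rewrite val_insubd rank_lt_card.
have fT : f @: A = setT.
  apply/eqP; rewrite eqEcard subsetT cardsT card_ord.
  rewrite card_in_imset ?leqnn // => p q pA qA.
  by move/(congr1 val); rewrite /= !fE //; apply: rank_inj.
have /imsetP[p pA e] : Ordinal aA \in f @: A by rewrite fT inE.
by exists p; rewrite // -fE // -e.
Qed.

Lemma rank_enumeration T :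
  exists e : 'I_#|T| -> 'I_d, forall a, e a \in T /\ rank T (e a) = a.
Proof.
have /fin_all_exists[e he] : forall a : 'I_#|T|, exists p, p \in T /\ rank T p = a.
  by move=> a; have [p ? ?] := rank_onto (ltn_ord a); exists p.
by exists e.
Qed.

Lemma ltn_rank_enumeration T (e : 'I_#|T| -> 'I_d) :
    (forall a, e a \in T /\ rank T (e a) = a) ->
  forall a b, (e a < e b) = (a < b).
Proof.
move=> he a b; have [eT <-] := he a; have [_ <-] := he b.
by rewrite ltn_rank.
Qed.

End Rank.

(** * Reductions and projections of patterns *)

Lemma exists_standardization (k d : nat) (s : 'I_k -> 'I_d) :
    injective s ->
  exists w : 'S_k, forall a, w a = rank [set s b | b in 'I_k] (s a) :> nat.
Proof.
move=> s_inj; set A := [set s b | b in 'I_k].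
have sA a : s a \in A by apply: imset_f.
have cA : #|A| = k by rewrite card_imset // card_ord.
have lt_k a : rank A (s a) < k by rewrite -[X in _ < X]cA rank_lt_card.
have w_inj : injective (fun a => Ordinal (lt_k a)).
  by move=> a b /(congr1 val) /= /rank_inj e; apply/s_inj/e.
by exists (perm w_inj) => a; rewrite permE.
Qed.

Lemma card_trace_patterns (n d l : nat) (pi : 'S_n) (T : {set 'I_d}) :
    #|T| = l ->
  #|trace (fun v : 'S_d => v) (patterns d pi) T|
    <= num_patterns l pi * 'C(d, l).
Proof.
move=> <-; have [e he] := rank_enumeration T.
have e_lt := ltn_rank_enumeration he.
have e_inj : injective e.
  by move=> a b ab; apply/val_inj => /=; have [_ <-] := he a;
    have [_ <-] := he b; rewrite ab.
(* Inverts reduction: the position [e a] receives the element of the value set whose rank is the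
   [a]-th entry of the pattern. *)
pose decode (wA : 'S_#|T| * {set 'I_d}) : {ffun 'I_d -> option 'I_d} :=
  [ffun i => if i \in T then
     [pick p in wA.2 | [exists a, (e a == i) && (rank wA.2 p == wA.1 a)]]
   else None].
pose D := setX (patterns #|T| pi) [set A : {set 'I_d} | #|A| == #|T|].
apply: (@leq_trans #|D|); last by rewrite cardsX card_draws card_ord.
apply: leq_trans (leq_imset_card decode D).
apply/subset_leq_card/subsetP => _ /imsetP[v vF ->].
have ve_inj : injective (fun a => v (e a)) by move=> a b /perm_inj/e_inj.
have [w hw] := exists_standardization ve_inj.
set A := [set v (e b) | b in 'I_#|T|] in hw.
have veA a : v (e a) \in A by apply: imset_f.
apply/imsetP; exists (w, A).
  rewrite !inE card_imset // card_ord eqxx andbT.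
  move: vF; rewrite inE => /existsP[j /andP[/forallP j_incr /forallP j_iso]].
  (* An occurrence of [v] at [j], read at the positions in [T] only, is an occurrence of its
     reduction [w]. *)
  apply/existsP; exists [ffun a => j (e a)]; apply/andP; split.
    apply/forallP => a; apply/forallP => b; rewrite !ffunE -e_lt.
    exact: (forallP (j_incr (e a))).
  apply/forallP => a; apply/forallP => b; rewrite !ffunE !hw ltn_rank //.
  exact: (forallP (j_iso (e a))).
apply/ffunP => i; rewrite !ffunE; case: ifP => // iT.
have [a ea] : exists a, e a = i.
  exists (Ordinal (rank_lt_card iT)).
  have [? r] := he (Ordinal (rank_lt_card iT)).
  exact: (@rank_inj _ T).
(* Any picked [p] has the rank of [v i] in [A], so it equals [v i]; the pick succeeds since [v i]
   qualifies. *)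
case: pickP => [p /= /andP[pA /existsP[b /andP[/eqP eb /eqP rp]]]|/(_ (v i)) /=].
  congr Some; apply: (@rank_inj _ A) => //; first by rewrite -ea.
  by rewrite rp hw eb.
rewrite -{1}ea veA /= => /existsP[]; exists a.
by rewrite ea eqxx hw ea eqxx.
Qed.

(** * Cyclic intervals and the final bound *)

Lemma card_ord_lt (d l : nat) : l <= d -> #|[set i : 'I_d | i < l]| = l.
Proof.
move=> ld; rewrite -sum1dep_card -(big_ord_widen _ (fun=> 1)) //.
by rewrite sum1_card card_ord.
Qed.

Lemma num_patterns_expn (n d l : nat) (pi : 'S_n) :
    0 < l -> l <= d ->
  num_patterns d pi ^ l <= (num_patterns l pi * 'C(d, l)) ^ d.
Proof.
(* Positions in ['I_d.+1] form a cyclic group, so both counts below are preimages of the first [l]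
   positions under a bijection. *)
case: d => [|d] l0 ld; first by case: l l0 ld.
set K := _ * _.
(* Cyclic intervals of length l: each position lies in exactly l of them. *)
pose T (j : 'I_d.+1) := [set i : 'I_d.+1 | (i - j)%R < l].
have cT j : #|T j| = l.
  rewrite -[RHS](card_ord_lt ld) -[RHS](card_preimset _ (addIr (- j)%R)).
  by apply: eq_card => i; rewrite !inE.
have cov i : #|[pred j | i \in T j]| = l.
  rewrite -[RHS](card_ord_lt ld).
  rewrite -[RHS](card_preimset _ (inj_comp (addrI i) (@oppr_inj _))).
  by apply: eq_card => j; rewrite !inE.
have -> : num_patterns d.+1 pi =
    #|trace (fun v : 'S_d.+1 => v) (patterns d.+1 pi) setT|.
  rewrite card_in_imset // => v w _ _ /eq_restriction vw.
  by apply/permP => i; apply: vw; rewrite inE.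
apply: leq_trans (shearer _ _ l0 (fun i _ => cov i)) _.
rewrite -[X in K ^ X](card_ord d.+1) -prod_nat_const.
by apply: leq_prod => j _; rewrite setIT card_trace_patterns.
Qed.

Unset Implicit Arguments.
Local Open Scope ring_scope.

Theorem theorem1 (R : realType) (n : nat) (pi : 'S_n) (l d : nat)
    (hl : (1 <= l)%N) (hld : (l < d)%N) (hdn : (d < n)%N) :
  (num_patterns d pi)%:R
    <= ((num_patterns l pi)%:R * 'C(d, l)%:R : R) `^ (d%:R / l%:R).
Proof.
(* Raising both nonnegative sides to the power [l] turns the exponent [d / l] into [d], leaving the
   inequality between naturals. *)
rewrite -natrM -(@ler_pXn2r _ l) ?nnegrE ?powR_ge0 //.
rewrite -(powR_mulrn _ (powR_ge0 _ _)) -powRrM divfK ?pnatr_eq0 -?lt0n //.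
by rewrite powR_mulrn ?ler0n // -!natrX ler_nat num_patterns_expn // ltnW.
Qed.
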